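(* Let $X\in\{CS,RS,TS,2S,3S,BS\}$. Validity of formulae in $\overline{\mathcal{L}}_X$ reduces in polynomial time (many-one) to the problem of deciding, given $\varphi\in\mathcal{L}_X$, whether $\varphi$ is characteristic for some process modulo $\equiv_X$.
   Context: Processes are states of finite labelled transition systems $(P,A,\to)$ with $A$ a finite nonempty action set. Hennessy–Milner logic $\mathcal{L}_{BS}$: $\varphi::=\mathbf{tt}\mid\mathbf{ff}\mid\varphi\wedge\varphi\mid\varphi\vee\varphi\mid\langle a\rangle\varphi\mid[a]\varphi\mid\neg\varphi$ with the usual semantics. Fragments: $\mathcal{L}_S$: $\varphi::=\mathbf{tt}\mid\mathbf{ff}\mid\varphi\wedge\varphi\mid\varphi\vee\varphi\mid\langle a\rangle\varphi$; $\mathcal{L}_{CS}$: $\mathcal{L}_S$ plus $\mathbf{0}:=\bigwedge_{a\in A}[a]\mathbf{ff}$; $\mathcal{L}_{RS}$: $\mathcal{L}_S$ plus $[a]\mathbf{ff}$; $\mathcal{L}_{TS}$: $\mathcal{L}_S$ plus $\psi::=\mathbf{ff}\mid[a]\psi$; $\mathcal{L}_{2S}$: $\mathcal{L}_S$ plus $\neg\psi$ for $\psi\in\mathcal{L}_S$; $\mathcal{L}_{3S}$: $\mathcal{L}_S$ plus $\neg\psi$ for $\psi\in\mathcal{L}_{2S}$ (each closed under $\wedge,\vee,\langle a\rangle$). The dual of a fragment is $\overline{\mathcal{L}}=\{\varphi:\neg\varphi\in\mathcal{L}\}$, with negation pushed inward via De Morgan laws, $\neg\langle a\rangle\varphi=[a]\neg\varphi$,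 $\neg[a]\varphi=\langle a\rangle\neg\varphi$, $\neg\mathbf{tt}=\mathbf{ff}$. A formula is valid if satisfied by every process of every finite LTS. $\mathcal{L}_X(p)=\{\psi\in\mathcal{L}_X:p\models\psi\}$. A formula $\varphi\in\mathcal{L}_X$ is characteristic for $p$ modulo $\equiv_X$ if for every process $q$, $q\models\varphi$ iff $\mathcal{L}_X(p)=\mathcal{L}_X(q)$. *)

(* Defs.v *)
From HB Require Import structures.
From mathcomp Require Import all_boot all_order all_algebra.

Set Implicit Arguments.
Unset Strict Implicit.
Unset Printing Implicit Defensive.

(** * Hennessy-Milner logic over finite labelled transition systems *)

Record lts (A : finType) := Lts {
  proc : finType;
  trans : proc -> A -> proc -> bool
}.

Inductive form (A : finType) : Type :=
| Tt
| Ff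
| And of form A & form A
| Or of form A & form A
| Dia of A & form A
| Box of A & form A
| Neg of form A.

Arguments Tt {A}.
Arguments Ff {A}.

Fixpoint sat (A : finType) (M : lts A) (p : proc M) (phi : form A) : bool :=
  match phi with
  | Tt => true
  | Ff => false
  | And phi1 phi2 => sat p phi1 && sat p phi2
  | Or phi1 phi2 => sat p phi1 || sat p phi2
  | Dia a phi' => [exists q, trans p a q && sat q phi']
  | Box a phi' => [forall q, trans p a q ==> sat q phi']
  | Neg phi' => ~~ sat p phi'
  end.

Definition valid (A : finType) (phi : form A) : Prop :=
  forall (M : lts A) (p : proc M), sat p phi.

(** * The fragments *)

Inductive logic := CS | RS | TS | S2 | S3 | BS.

(* The least set of formulae containing [extra], [Tt] and [Ff] that is closed
   under conjunction, disjunction and diamonds. *)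
Inductive simulation_closure (A : finType) (extra : form A -> Prop) :
  form A -> Prop :=
| sc_tt : simulation_closure extra Tt
| sc_ff : simulation_closure extra Ff
| sc_and phi psi : simulation_closure extra phi ->
    simulation_closure extra psi -> simulation_closure extra (And phi psi)
| sc_or phi psi : simulation_closure extra phi ->
    simulation_closure extra psi -> simulation_closure extra (Or phi psi)
| sc_dia a phi : simulation_closure extra phi ->
    simulation_closure extra (Dia a phi)
| sc_extra phi : extra phi -> simulation_closure extra phi.

(* Associates to the right; the unit [Tt] occurs only if the list is empty. *)
Fixpoint conjs (A : finType) (s : seq (form A)) : form A :=
  match s with
  | [::] => Tt
  | [:: phi] => phi
  | phi :: s' => And phi (conjs s')
  end.

Definition deadlock (A : finType) : form A :=
  conjs [seq Box a Ff | a <- enum A].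

Inductive failed_trace (A : finType) : form A -> Prop :=
| ft_ff : failed_trace Ff
| ft_box a psi : failed_trace psi -> failed_trace (Box a psi).

Definition in_S (A : finType) : form A -> Prop :=
  simulation_closure (fun _ => False).

Definition in_2S (A : finType) : form A -> Prop :=
  simulation_closure (fun phi => exists2 psi, in_S psi & phi = Neg psi).

Definition in_3S (A : finType) : form A -> Prop :=
  simulation_closure (fun phi => exists2 psi, in_2S psi & phi = Neg psi).

Definition in_logic (A : finType) (X : logic) : form A -> Prop :=
  match X with
  | CS => simulation_closure (fun phi => phi = deadlock A)
  | RS => simulation_closure (fun phi => exists a, phi = Box a Ff)
  | TS => simulation_closure (@failed_trace A)
  | S2 => @in_2S A
  | S3 => @in_3S A
  | BS => fun _ => True
  end.

(** * Dual fragments *)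

(* Negation normal form of [phi] if [b = false], of [Neg phi] if [b = true]. *)
Fixpoint push (A : finType) (b : bool) (phi : form A) : form A :=
  match phi with
  | Tt => if b then Ff else Tt
  | Ff => if b then Tt else Ff
  | And phi1 phi2 => (if b then @Or A else @And A) (push b phi1) (push b phi2)
  | Or phi1 phi2 => (if b then @And A else @Or A) (push b phi1) (push b phi2)
  | Dia a phi' => (if b then @Box A else @Dia A) a (push b phi')
  | Box a phi' => (if b then @Dia A else @Box A) a (push b phi')
  | Neg phi' => push (~~ b) phi'
  end.

Definition nnf (A : finType) (phi : form A) : form A := push false phi.

(* [Neg phi] belongs to the fragment up to pushing negations inward.  Both
   sides have to be normalized, since the fragments [S2] and [S3] themselves
   contain formulae with negations: [Box a Ff] lies in the dual of [S2]
   through [Dia a (Neg Ff)] or [Dia a Tt], and [Dia a Tt] through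
   [Neg (Dia a Tt)]. *)
Definition in_dual (A : finType) (X : logic) (phi : form A) : Prop :=
  exists2 psi, in_logic X psi & nnf (Neg phi) = nnf psi.

(** * Characteristic formulae *)

Definition logic_equiv (A : finType) (X : logic)
    (M : lts A) (p : proc M) (N : lts A) (q : proc N) : Prop :=
  forall psi : form A, in_logic X psi -> sat p psi = sat q psi.

Definition characteristic_for (A : finType) (X : logic)
    (M : lts A) (p : proc M) (phi : form A) : Prop :=
  in_logic X phi /\
  forall (N : lts A) (q : proc N), sat q phi <-> logic_equiv X p q.

Definition characteristic (A : finType) (X : logic) (phi : form A) : Prop :=
  exists (M : lts A) (p : proc M), characteristic_for X p phi.

(** * Polynomial time on deterministic multitape Turing machines *)

Inductive move := Left | Stay | Right.

(* Tape [ord0] is the input tape and tape [ord_max] the output tape. In a cell,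
   [None] is the blank and [inr] marks auxiliary tape symbols. *)
Record machine (Sigma : finType) := Machine {
  ntapes' : nat;
  state : finType;
  work : finType;
  start : state;
  final : pred state;
  delta : state -> {ffun 'I_ntapes'.+1 -> option (Sigma + work)} ->
          state * {ffun 'I_ntapes'.+1 -> option (Sigma + work) * move}
}.

Section Run.
Variables (Sigma : finType) (M : machine Sigma).

Definition cell : Type := option (Sigma + work M).

(* [(l, r)] is the two-way infinite tape whose content is [rev l ++ r],
   surrounded by blanks, with the head on the first cell of [r]. *)
Definition tape : Type := seq cell * seq cell.

Definition config : Type := state M * {ffun 'I_(ntapes' M).+1 -> tape}.

Definition read (t : tape) : cell := head None t.2.

Definition write_move (t : tape) (x : cell * move) : tape :=
  let: (l, r) := t in
  match x.2 with
  | Left => (behead l, head None l :: x.1 :: behead r)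
  | Stay => (l, x.1 :: behead r)
  | Right => (x.1 :: l, behead r)
  end.

Definition step (c : config) : config :=
  if final c.1 then c else
  let: (q, acts) := delta c.1 [ffun i => read (c.2 i)] in
  (q, [ffun i => write_move (c.2 i) (acts i)]).

Definition letters (w : seq Sigma) : seq cell := [seq Some (inl x) | x <- w].

Definition init (w : seq Sigma) : config :=
  (start M, [ffun i => if i == ord0 then ([::], letters w) else ([::], [::])]).

Definition contains (t : tape) (w : seq Sigma) : Prop :=
  exists m n, rev t.1 ++ t.2 = nseq m None ++ letters w ++ nseq n None.

Definition halts_within (n : nat) (w v : seq Sigma) : Prop :=
  exists2 t, t <= n &
    let c := iter t step (init w) in final c.1 /\ contains (c.2 ord_max) v.

End Run.

Definition polytime (Sigma : finType) (f : seq Sigma -> seq Sigma) : Prop :=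
  exists (M : machine Sigma) (P : {poly nat}),
    forall w, halts_within M P.[size w]%R w (f w).

(* A decision problem: a set of instances, the yes-instances among them, and
   the representation of instances as words. *)
Record problem (Sigma : finType) := Problem {
  input : Type;
  encode : input -> seq Sigma;
  instance : input -> Prop;
  yes : input -> Prop
}.

Definition polytime_reducible (Sigma : finType) (P Q : problem Sigma) : Prop :=
  exists2 f : seq Sigma -> seq Sigma, polytime f &
    forall x : input P, instance x ->
      exists y : input Q,
        [/\ instance y, f (encode x) = encode y & yes x <-> yes y].

(** * Formulae as words (Polish notation) *)

Inductive token (A : Type) : Type :=
| KTt | KFf | KAnd | KOr | KNeg | KDia of A | KBox of A.

Arguments KTt {A}.
Arguments KFf {A}.
Arguments KAnd {A}.
Arguments KOr {A}.
Arguments KNeg {A}.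

Definition token_code (A : Type) (k : token A) : 'I_5 + (A + A) :=
  match k with
  | KTt => inl (inord 0)
  | KFf => inl (inord 1)
  | KAnd => inl (inord 2)
  | KOr => inl (inord 3)
  | KNeg => inl (inord 4)
  | KDia a => inr (inl a)
  | KBox a => inr (inr a)
  end.

Definition token_decode (A : Type) (c : 'I_5 + (A + A)) : token A :=
  match c with
  | inl i => nth KNeg [:: KTt; KFf; KAnd; KOr; KNeg] i
  | inr (inl a) => KDia a
  | inr (inr a) => KBox a
  end.

Lemma token_codeK (A : Type) : cancel (@token_code A) (@token_decode A).
Proof. by case=> //= [||||]; rewrite inordK. Qed.

HB.instance Definition _ (A : finType) :=
  Finite.copy (token A) (can_type (@token_codeK A)).

Fixpoint polish (A : finType) (phi : form A) : seq (token A) :=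
  match phi with
  | Tt => [:: KTt]
  | Ff => [:: KFf]
  | And phi1 phi2 => KAnd :: polish phi1 ++ polish phi2
  | Or phi1 phi2 => KOr :: polish phi1 ++ polish phi2
  | Dia a phi' => KDia a :: polish phi'
  | Box a phi' => KBox a :: polish phi'
  | Neg phi' => KNeg :: polish phi'
  end.

Lemma polish_prefix (A : finType) (phi psi : form A) (u v : seq (token A)) :
  polish phi ++ u = polish psi ++ v -> phi = psi /\ u = v.
Proof.
elim: phi psi u v => [||f1 IH1 f2 IH2|f1 IH1 f2 IH2|a f IH|a f IH|f IH]
  [||g1 g2|g1 g2|b g|b g|g] u v //= [];
  rewrite -?catA.
- by [].
- by [].
- by move=> /IH1[-> /IH2[-> ->]].
- by move=> /IH1[-> /IH2[-> ->]].
- by move=> -> /IH[-> ->].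
- by move=> -> /IH[-> ->].
- by move=> /IH[-> ->].
Qed.

Lemma polish_inj (A : finType) : injective (@polish A).
Proof.
by move=> phi psi e; case: (@polish_prefix _ phi psi [::] [::]); rewrite ?e.
Qed.

Definition dual_validity (A : finType) (X : logic) : problem (token A) :=
  {| encode := @polish A; instance := in_dual X; yes := @valid A |}.

Definition characteristic_formula (A : finType) (X : logic) :
    problem (token A) :=
  {| encode := @polish A; instance := in_logic X; yes := characteristic X |}.

(* Main.v *)
(** A formula is valid iff its negation is unsatisfiable. If [psi] is a member
    of the fragment equivalent to [Neg phi], then [Or 0 (Dia a psi)], where [0]
    expresses the absence of transitions, is equivalent to [0], which is
    characteristic for the deadlocked process, when [phi] is valid; otherwise
    it is satisfied by processes that differ on [0], so that it is not
    characteristic.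

    For CS, RS and TS the formula [psi] is the negation normal form of
    [Neg phi]. For 2S and 3S boxes must be replaced with [Neg (Dia a _)]; doing
    so top down, and cancelling double negations, introduces no more nested
    negations than the fragment allows. Both translations only have to know, at
    each token of the Polish notation, whether the subformula starting there is
    to be negated; these bits are kept on a stack, which gives a linear time
    machine. *)

Require Import Defs.
From mathcomp Require Import all_boot all_order all_algebra.
Import Defs. (* [all_algebra] also has a [form] *)

Set Implicit Arguments.
Unset Strict Implicit.
Unset Printing Implicit Defensive.

(** * Normal forms *)

Section NormalForm.
Variable A : finType.
Implicit Types (phi psi : form A) (M : lts A) (s c b : bool).

(* The result has no negations if [s = false], no boxes if [s = true]; it is
   equivalent to [Neg phi] instead of [phi] if [c = true]. *)
Fixpoint normal s c phi : form A :=
  match phi with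
  | Tt => if c then Ff else Tt
  | Ff => if c then Tt else Ff
  | And f g => (if c then @Or A else @And A) (normal s c f) (normal s c g)
  | Or f g => (if c then @And A else @Or A) (normal s c f) (normal s c g)
  | Dia a f =>
      let g := normal s (c && ~~ s) f in
      if c then if s then Neg (Dia a g) else Box a g else Dia a g
  | Box a f =>
      let g := normal s (c || s) f in
      if c then Dia a g else if s then Neg (Dia a g) else Box a g
  | Neg f => normal s (~~ c) f
  end.

Lemma sat_normal s c phi M (p : proc M) :
  sat p (normal s c phi) = c (+) sat p phi.
Proof.
elim: phi c p => [||f IHf g IHg|f IHf g IHg|a f IH|a f IH|f IH] c p /=.
- by case: c.
- by case: c.
- by case: c => /=; rewrite IHf IHg //= negb_and.
- by case: c => /=; rewrite IHf IHg //= negb_or.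
- case: c => /=; last by apply: eq_existsb => q; rewrite IH.
  case: s IH => IH /=.
    by congr (~~ _); apply: eq_existsb => q; rewrite IH.
  rewrite negb_exists; apply: eq_forallb => q.
  by rewrite IH negb_and implybE.
- case: c => /=.
    by rewrite negb_forall; apply: eq_existsb => q; rewrite IH negb_imply.
  case: s IH => IH /=; last by apply: eq_forallb => q; rewrite IH.
  rewrite negb_exists; apply: eq_forallb => q.
  by rewrite IH negb_and negbK implybE.
- by rewrite IH; case: c; case: (sat p f).
Qed.

Lemma normal_pushE c phi : normal false c phi = push c phi.
Proof.
by elim: phi c => //= [f IHf g IHg|f IHf g IHg|a f IH|a f IH] c;
  rewrite ?IHf ?IHg ?IH; case: c.
Qed.

(** Hence the box-free form of a formula depends only on its negation normal form, which is all that
    [in_dual] controls. *)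
Lemma normal_push c b phi :
  normal true c (push b phi) = normal true (c (+) b) phi.
Proof.
elim: phi c b => [||f IHf g IHg|f IHf g IHg|a f IH|a f IH|f IH] c b /=.
- by case: c; case: b.
- by case: c; case: b.
- by case: b; rewrite /= IHf IHg; case: c.
- by case: b; rewrite /= IHf IHg; case: c.
- by case: b; rewrite /= IH; case: c.
- by case: b; rewrite /= IH; case: c.
- by rewrite IH; case: c; case: b.
Qed.

End NormalForm.

(** * Membership in the fragments *)

Section Fragments.
Variable A : finType.
Implicit Types (phi psi : form A) (E : form A -> Prop).

Lemma simulation_closure_sub E E' phi :
  (forall psi, E psi -> simulation_closure E' psi) ->
  simulation_closure E phi -> simulation_closure E' phi.
Proof.
move=> EE'; elim=> {phi} [||f g _ IHf _ IHg|f g _ IHf _ IHg|a f _ IH|f /EE' //].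
- exact: sc_tt.
- exact: sc_ff.
- exact: sc_and.
- exact: sc_or.
- exact: sc_dia.
Qed.

Lemma in_S_closure E phi : in_S phi -> simulation_closure E phi.
Proof. exact: simulation_closure_sub. Qed.

Lemma in_2S_in_3S phi : in_2S phi -> in_3S phi.
Proof.
apply: simulation_closure_sub => _ [psi Spsi ->].
by apply: sc_extra; exists psi => //; apply: in_S_closure.
Qed.

Lemma simulation_closure_conjs E (B : eqType) (h : B -> form A) (r : seq B) :
  (forall a, simulation_closure E (h a)) ->
  simulation_closure E (conjs [seq h a | a <- r]).
Proof.
move=> Eh; elim: r => [|a [|b r] IH]; first exact: sc_tt.
  exact: Eh.
by apply: sc_and.
Qed.

Lemma normal_conjs s (r : seq (form A)) :
  normal s false (conjs r) = conjs [seq normal s false phi | phi <- r].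
Proof. by elim: r => [|f [|g r] IH] //; apply: congr1 IH. Qed.

Lemma normal_closure E E' s phi :
  (forall psi, E psi -> simulation_closure E' (normal s false psi)) ->
  simulation_closure E phi -> simulation_closure E' (normal s false phi).
Proof.
move=> EE'.
elim=> {phi} /= [||f g _ IHf _ IHg|f g _ IHf _ IHg|a f _ IH|f /EE' //].
- exact: sc_tt.
- exact: sc_ff.
- exact: sc_and.
- exact: sc_or.
- exact: sc_dia.
Qed.

Lemma push_false_closure E phi : (forall psi, E psi -> push false psi = psi) ->
  simulation_closure E phi -> push false phi = phi.
Proof.
by move=> EK; elim=> {phi} //= [f g _ -> _ ->|f g _ -> _ ->|a f _ ->].
Qed.

Lemma in_S_normal phi : in_S phi -> in_S (normal true false phi).
Proof. exact: normal_closure. Qed.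

Lemma normal_neg_in_S phi : in_S phi -> in_2S (normal true true phi).
Proof.
elim=> {phi} //= [||f g _ IHf _ IHg|f g _ IHf _ IHg|a f Sf _].
- exact: sc_ff.
- exact: sc_tt.
- exact: sc_or.
- exact: sc_and.
- apply: sc_extra; exists (Dia a (normal true false f)) => //.
  exact/sc_dia/in_S_normal.
Qed.

Lemma in_2S_normal phi : in_2S phi -> in_2S (normal true false phi).
Proof. by apply: normal_closure => _ [psi Spsi ->]; apply: normal_neg_in_S. Qed.

(** Only diamonds acquire a negation, and their bodies are then normalized positively, so they stay
    in 2S; a negation already present cancels and leaves a formula of S. *)
Lemma normal_neg_in_2S phi : in_2S phi -> in_3S (normal true true phi).
Proof.
elim=> {phi} /= [||f g _ IHf _ IHg|f g _ IHf _ IHg|a f Sf _|_ [psi Spsi ->]].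
- exact: sc_ff.
- exact: sc_tt.
- exact: sc_or.
- exact: sc_and.
- apply: sc_extra; exists (Dia a (normal true false f)) => //.
  exact/sc_dia/in_2S_normal.
- exact/in_S_closure/in_S_normal.
Qed.

Lemma in_3S_normal phi : in_3S phi -> in_3S (normal true false phi).
Proof.
by apply: normal_closure => _ [psi Spsi ->]; apply: normal_neg_in_2S.
Qed.

Definition box_free (X : logic) : bool :=
  match X with S2 | S3 => true | _ => false end.

Lemma push_false_deadlock : push false (deadlock A) = deadlock A.
Proof.
rewrite -normal_pushE /deadlock normal_conjs -map_comp.
by congr conjs; apply: eq_map.
Qed.

Lemma push_false_failed_trace phi : failed_trace phi -> push false phi = phi.
Proof. by elim=> //= a psi _ ->. Qed.

(** Members of CS, RS and TS are their own negation normal forms, so there the result is the witness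
    [psi] itself; for 2S and 3S it is the box-free form of [psi]. *)
Lemma normal_in_logic X phi :
  in_dual X phi -> in_logic X (normal (box_free X) true phi).
Proof.
case=> psi; rewrite /nnf /= => Xpsi e.
have e' : normal true true phi = normal true false psi.
  by rewrite -[LHS](normal_push false true) e normal_push.
case: X Xpsi => //= Xpsi; rewrite ?normal_pushE ?e'.
- rewrite e (push_false_closure _ Xpsi) // => _ ->.
  exact: push_false_deadlock.
- by rewrite e (push_false_closure _ Xpsi) // => _ [a ->].
- rewrite e (push_false_closure _ Xpsi) //.
  exact: push_false_failed_trace.
- exact: in_2S_normal.
- exact: in_3S_normal.
Qed.

Lemma normal_deadlock_in_logic X :
  in_logic X (normal (box_free X) false (deadlock A)).
Proof.
have S2deadlock : in_2S (normal true false (deadlock A)).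
  (* Each conjunct [Box a Ff] has become [Neg (Dia a Tt)]. *)
  rewrite normal_conjs -map_comp; apply: simulation_closure_conjs => a /=.
  by apply: sc_extra; exists (Dia a Tt) => //; apply/sc_dia/sc_tt.
case: X; rewrite /= ?normal_pushE ?push_false_deadlock //.
- exact: sc_extra.
- by apply: simulation_closure_conjs => a; apply: sc_extra; exists a.
- by apply: simulation_closure_conjs => a; apply/sc_extra/ft_box/ft_ff.
- exact: in_2S_in_3S.
Qed.

Lemma in_logic_or X phi psi :
  in_logic X phi -> in_logic X psi -> in_logic X (Or phi psi).
Proof. by case: X => //=; apply: sc_or. Qed.

Lemma in_logic_dia X a phi : in_logic X phi -> in_logic X (Dia a phi).
Proof. by case: X => //=; apply: sc_dia. Qed.

End Fragments.

(** * Validity as characteristicness *)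

Section Semantics.
Variable A : finType.
Implicit Types (phi psi : form A) (M N : lts A).

Lemma sat_conjs M (p : proc M) (r : seq (form A)) :
  sat p (conjs r) = all (sat p) r.
Proof.
elim: r => [|f [|g r] IH] //=; first by rewrite andbT.
exact: (congr1 (andb _) IH).
Qed.

Lemma sat_deadlock M (p : proc M) :
  sat p (deadlock A) = [forall a, forall q, ~~ trans p a q].
Proof.
rewrite sat_conjs all_map; apply/allP/forallP => [H a|H a _] /=.
  have /forallP/= Ha := H a (mem_enum _ a).
  by apply/forallP => q; have := Ha q; rewrite implybF.
by apply/forallP => q; rewrite implybF; move/forallP: (H a).
Qed.

Lemma sat_deadlockP M (p : proc M) :
  reflect (forall a q, trans p a q = false) (sat p (deadlock A)).
Proof.
rewrite sat_deadlock; apply: (iffP forallP) => [H a q|H a].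
  by apply/negbTE; have /forallP := H a.
by apply/forallP => q; rewrite H.
Qed.

(** Without transitions every diamond is false and every box true, whatever the process. *)
Lemma deadlock_sat_eq M N (p : proc M) (q : proc N) phi :
  sat p (deadlock A) -> sat q (deadlock A) -> sat p phi = sat q phi.
Proof.
move=> /sat_deadlockP dp /sat_deadlockP dq.
elim: phi => //= [f -> g ->|f -> g ->|a f _|a f _|f ->] //.
- by apply/existsP/existsP => -[r]; rewrite ?dp ?dq.
- by apply/forallP/forallP => _ r; rewrite ?dp ?dq.
Qed.

Definition deadlock_lts : lts A := @Lts A unit (fun _ _ _ => false).

Lemma sat_deadlock_lts : @sat A deadlock_lts tt (deadlock A).
Proof. exact/sat_deadlockP. Qed.

(** [None] is a fresh root above [p]; no transition leads back to it, so the states of [M] keep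
    their behaviour. *)
Definition prefix_lts M (a : A) (p : proc M) : lts A :=
  @Lts A (option (proc M)) (fun x b y =>
    match x, y with
    | Some x, Some y => trans x b y
    | None, Some y => (b == a) && (y == p)
    | _, None => false
    end).

Lemma sat_prefix_lts M a (p q : proc M) phi :
  @sat A (prefix_lts a p) (Some q) phi = sat q phi.
Proof.
elim: phi q => //= [f IHf g IHg|f IHf g IHg|b f IH|b f IH|f IH] q;
  rewrite ?IHf ?IHg ?IH //.
- apply/existsP/existsP => [[[r|] //= H]|[r H]].
    by exists r; rewrite -IH.
  by exists (Some r); rewrite /= IH.
- apply/forallP/forallP => [H r|H [r|] //=].
    by have := H (Some r); rewrite /= IH.
  by rewrite IH; apply: H.
Qed.

Lemma characteristic_valid X (a : A) phi (zero psi : form A) :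
    in_logic X zero -> in_logic X psi ->
    (forall M (p : proc M), sat p zero = sat p (deadlock A)) ->
    (forall M (p : proc M), sat p psi = ~~ sat p phi) ->
  valid phi <-> characteristic X (Or zero (Dia a psi)).
Proof.
move=> Xzero Xpsi zeroE psiE; split=> [valid_phi|[M [p [_ charp]]] N q].
  exists deadlock_lts, tt; split=> [|N q].
    by apply: in_logic_or => //; apply: in_logic_dia.
  have -> : sat q (Or zero (Dia a psi)) = sat q (deadlock A).
    rewrite /= zeroE; case: existsP => [[r]|_]; last exact: orbF.
    by rewrite psiE valid_phi andbF.
  split=> [dq theta _|/(_ _ Xzero)]; last by rewrite !zeroE sat_deadlock_lts.
  exact: deadlock_sat_eq sat_deadlock_lts dq.
apply/idPn => nphi.
(* The deadlocked process satisfies the disjunction through [zero], so [p] must agree with it on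
   [zero]. *)
have sat_p_zero : sat p zero.
  have /charp/(_ _ Xzero) -> : @sat A deadlock_lts tt (Or zero (Dia a psi)).
    by rewrite /= zeroE sat_deadlock_lts.
  by rewrite zeroE sat_deadlock_lts.
(* The fresh root above the counterexample [q] satisfies the diamond, yet its transition refutes
   [zero], so it cannot be equivalent to [p]. *)
have /charp/(_ _ Xzero) : @sat A (prefix_lts a q) None (Or zero (Dia a psi)).
  rewrite /=; apply/orP; right; apply/existsP; exists (Some q).
  by rewrite /= !eqxx psiE sat_prefix_lts.
rewrite sat_p_zero zeroE => /esym/sat_deadlockP/(_ a (Some q)).
by rewrite /= !eqxx.
Qed.

End Semantics.

(** * The translation on words *)

Section Transducer.
Variable A : finType.
Implicit Types (k : token A) (w : seq (token A)) (s c : bool) (st : seq bool).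

Definition opens_neg s c k : bool :=
  match k with KDia _ => s && c | KBox _ => s && ~~ c | _ => false end.

Definition image s c k : option (token A) :=
  match k with
  | KTt => Some (if c then KFf else KTt)
  | KFf => Some (if c then KTt else KFf)
  | KAnd => Some (if c then KOr else KAnd)
  | KOr => Some (if c then KAnd else KOr)
  | KNeg => None
  | KDia a => Some (if c && ~~ s then KBox a else KDia a)
  | KBox a => Some (if c || s then KDia a else KBox a)
  end.

Definition child s c k : bool :=
  match k with
  | KNeg => ~~ c
  | KDia _ => c && ~~ s
  | KBox _ => c || s
  | _ => c
  end.

Definition is_leaf k : bool :=
  match k with KTt | KFf => true | _ => false end.
Definition is_binary k : bool :=
  match k with KAnd | KOr => true | _ => false end.

(* [c] is the polarity of the subformula that starts with the next token, [st]
   the stack of those of the pending right operands. The default [true] is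
   also the polarity of the whole input, so that the stack tape may start
   blank. *)
Fixpoint translate s c st w : seq (token A) :=
  if w is k :: w' then
    nseq (opens_neg s c k) KNeg ++ seq_of_opt (image s c k) ++
    (if is_leaf k then translate s (head true st) (behead st) w'
     else translate s (child s c k) (if is_binary k then c :: st else st) w')
  else [::].

(** The induction needs arbitrary [w] and [st]: the last leaf of a left operand pops the polarity
    that was pushed for the right one. *)
Lemma translate_polish s c st phi w :
  translate s c st (polish phi ++ w) =
  polish (normal s c phi) ++ translate s (head true st) (behead st) w.
Proof.
elim: phi c st w => [||f IHf g IHg|f IHf g IHg|a f IH|a f IH|f IH] c st w /=.
- by case: c.
- by case: c.
- by rewrite -catA IHf /= IHg; case: c; rewrite /= catA.
- by rewrite -catA IHf /= IHg; case: c; rewrite /= catA.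
- by rewrite IH; case: c; case: s {IH}.
- by rewrite IH; case: c; case: s {IH}.
- exact: IH.
Qed.

End Transducer.

(** * The machine *)

Section Machine.
Variables (A : finType) (s : bool) (pre : seq (token A)).

Definition symbol : Type := option (token A + bool).

(* In state [inl i] the machine writes the letter [i] of [pre] or, when none is
   left, starts to process the next token; it finishes with this token in state
   [inr (Some c)], [c] being the polarity found on top of the stack, and halts
   in state [inr None]. *)
Definition phase : finType := ('I_(size pre).+1 + option bool)%type.

Definition polarity (x : symbol) : bool :=
  if x is Some (inr b) then b else true.

(** A token takes two steps: it may emit two letters, [KNeg] and its image, and a push moves the
    stack head in the first step and fills the new cell in the second. *)
Definition action (q : phase) (x y z : symbol) :
    phase * ((symbol * move) * (symbol * move) * (symbol * move)) :=
  match q with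
  | inl i =>
      if i < size pre then
        (inl (inord i.+1),
         ((x, Stay), (y, Stay), (Some (inl (nth KTt pre i)), Right)))
      else if x is Some (inl k) then
        let c := polarity y in
        (inr (Some c),
         ((x, Stay),
          if is_leaf k then (None, Left)
          else (Some (inr (child s c k)), if is_binary k then Right else Stay),
          if opens_neg s c k then (Some (inl KNeg), Right) else (z, Stay)))
      else (inr None, ((x, Stay), (y, Stay), (z, Stay)))
  | inr (Some c) =>
      let k := if x is Some (inl k) then k else KTt in
      (inl ord_max,
       ((x, Right),
        (if is_binary k then Some (inr c) else y, Stay),
        if image s c k is Some k' then (Some (inl k'), Right) else (z, Stay)))
  | inr None => (q, ((x, Stay), (y, Stay), (z, Stay)))
  end.

Definition triple T (x y z : T) : {ffun 'I_3 -> T} :=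
  [ffun i => if i == ord0 then x else if i == ord_max then z else y].

Definition stack_index : 'I_3 := Ordinal (isT : 1 < 3).

Definition translator : machine (token A) :=
  @Machine (token A) 2 phase bool (inl ord0) (pred1 (inr None))
    (fun q rd =>
       let: (q', (x, y, z)) :=
         action q (rd ord0) (rd stack_index) (rd ord_max) in
       (q', triple x y z)).

Notation step := (@step _ translator).
Notation letters := (@letters _ translator).
Implicit Types (t : tape translator) (c : bool) (st : seq bool).
Implicit Types (k : token A) (w v : seq (token A)).

Lemma stepE (q : phase) t0 t1 t2 : q != inr None ->
  step (q, triple t0 t1 t2) =
  let: (q', (x, y, z)) := action q (read t0) (read t1) (read t2) in
  (q', triple (write_move t0 x) (write_move t1 y) (write_move t2 z)).
Proof.
rewrite /Defs.step /= => /negbTE ->; rewrite !ffunE /=.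
case: action => q' [[x y] z]; congr pair; apply/ffunP => i; rewrite !ffunE.
by case: ifP => // _; case: ifP.
Qed.

(** * Tape invariants and their preservation *)

Definition holds_input t w : Prop := exists n, t.2 = letters w ++ nseq n None.

(** The top is compared through [polarity], so that a blank cell represents the default [true] of an
    empty stack. *)
Definition holds_stack t c st : Prop :=
  [/\ polarity (read t) = c, map polarity t.1 = st
    & exists n, behead t.2 = nseq n None].

Definition holds_output t v : Prop :=
  t.1 = rev (letters v) /\ exists n, t.2 = nseq n None.

Lemma read_input t k w : holds_input t (k :: w) -> read t = Some (inl k).
Proof. by case=> n; rewrite /read => ->. Qed.

Lemma read_end t : holds_input t [::] -> read t = None.
Proof. by case=> -[|n]; rewrite /read => ->. Qed.

Lemma stay_input t w :
  holds_input t w -> holds_input (write_move t (read t, Stay)) w.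
Proof.
case: t => l r [n /= ->]; rewrite /read /=.
case: w => [|k w]; last by exists n.
by case: n => [|n]; [exists 1 | exists n.+1].
Qed.

Lemma right_input t k w x :
  holds_input t (k :: w) -> holds_input (write_move t (x, Right)) w.
Proof. by case: t => l r [n /= ->]; exists n. Qed.

Lemma stay_stack t c st b :
  holds_stack t c st -> holds_stack (write_move t (Some (inr b), Stay)) b st.
Proof. by case: t => l r []. Qed.

Lemma keep_stack t c st :
  holds_stack t c st -> holds_stack (write_move t (read t, Stay)) c st.
Proof. by case: t => l r []. Qed.

Lemma pop_stack t c st : holds_stack t c st ->
  holds_stack (write_move t (None, Left)) (head true st) (behead st).
Proof.
case: t => l r [_ <- [n /= nr]]; split=> /=; try by case: l.
by exists n.+1; rewrite nr.
Qed.

Lemma push_stack t c st b : holds_stack t c st ->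
  holds_stack
    (write_move (write_move t (Some (inr b), Right)) (Some (inr b), Stay))
    b (b :: st).
Proof.
case: t => l r [_ <- [n /= ->]]; split=> //=.
by exists n.-1; case: n.
Qed.

Lemma emit_output t v k : holds_output t v ->
  holds_output (write_move t (Some (inl k), Right)) (rcons v k).
Proof.
case: t => l r [/= -> [n ->]]; split=> /=.
  by rewrite /Defs.letters map_rcons rev_rcons.
by exists n.-1; case: n.
Qed.

Lemma keep_output t v :
  holds_output t v -> holds_output (write_move t (read t, Stay)) v.
Proof.
case: t => l r [/= -> [n ->]]; split=> //=.
by case: n => [|n]; [exists 1 | exists n.+1].
Qed.

Lemma translator_token k w c st v t0 t1 t2 :
  holds_input t0 (k :: w) -> holds_stack t1 c st -> holds_output t2 v ->
  exists t0' t1' t2',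
    [/\ step (step (inl ord_max, triple t0 t1 t2)) =
          (inl ord_max, triple t0' t1' t2'),
        holds_input t0' w,
        (if is_leaf k then holds_stack t1' (head true st) (behead st)
         else holds_stack t1' (child s c k)
                (if is_binary k then c :: st else st))
      & holds_output t2'
          (v ++ nseq (opens_neg s c k) KNeg ++ seq_of_opt (image s c k))].
Proof.
move=> in0 stk1 out2; have [pol1 _ _] := stk1.
have in0' := stay_input in0.
rewrite !stepE //= ltnn (read_input in0) /= -(read_input in0) stepE //=.
rewrite (read_input in0') /= pol1.
do 3 eexists; split; first by [].
- exact: right_input in0'.
- case: (boolP (is_leaf k)) => leaf_k.
    have -> : is_binary k = false by case: k leaf_k {in0 in0'}.
    exact/keep_stack/pop_stack/stk1.
  case: (boolP (is_binary k)) => bin_k; last exact/keep_stack/stay_stack/stk1.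
  (* A binary connective passes its polarity on unchanged, so the old top and the new cell both hold
     [c]. *)
  have -> : child s c k = c by case: k bin_k {in0 in0' leaf_k}.
  exact/push_stack/stk1.
- set t2' := write_move t2 _.
  have : holds_output t2' (v ++ nseq (opens_neg s c k) KNeg).
    rewrite /t2'; case: opens_neg; last by rewrite cats0; apply: keep_output.
    by rewrite cats1; apply: emit_output.
  rewrite catA; case: image => [k'|] out2' /=.
    by rewrite cats1; apply: emit_output.
  by rewrite cats0; apply: keep_output.
Qed.

(** Two steps per token, plus one that meets the end of the input and halts. *)
Lemma translator_input w c st v t0 t1 t2 :
  holds_input t0 w -> holds_stack t1 c st -> holds_output t2 v ->
  let cfg := iter (size w).*2.+1 step (inl ord_max, triple t0 t1 t2) in
  final cfg.1 /\ holds_output (cfg.2 ord_max) (v ++ translate s c st w).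
Proof.
elim: w c st v t0 t1 t2 => [|k w IH] c st v t0 t1 t2 in0 stk1 out2.
  rewrite /= stepE //= ltnn (read_end in0) /=; split=> //.
  by rewrite ffunE /= cats0; apply: keep_output.
have [t0' [t1' [t2' [e in0' stk1' out2']]]] := translator_token in0 stk1 out2.
rewrite [size _]/= doubleS 2!iterSr e.
rewrite /= !catA -[(v ++ _) ++ _]catA.
by case: ifP stk1' => _ stk1'; apply: IH in0' stk1' out2'.
Qed.

Lemma translator_prefix w i : i <= size pre -> exists t0 t1 t2,
  [/\ iter i step (init translator w) = (inl (inord i), triple t0 t1 t2),
      holds_input t0 w, holds_stack t1 true [::]
    & holds_output t2 (take i pre)].
Proof.
elim: i => [_|i IH lt_i].
  exists ([::], letters w), ([::], [::]), ([::], [::]); split.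
  - rewrite /= /init; congr pair.
      by congr inl; apply: val_inj; rewrite /= inordK.
    by apply/ffunP => i; rewrite !ffunE if_same.
  - by exists 0; rewrite cats0.
  - by split=> //; exists 0.
  - by rewrite take0; split=> //; exists 0.
have [t0 [t1 [t2 [e in0 stk1 out2]]]] := IH (ltnW lt_i).
rewrite iterS e stepE //= inordK ?lt_i; last exact: leqW.
do 3 eexists; split; first by [].
- exact: stay_input.
- exact: keep_stack.
- by rewrite (take_nth KTt lt_i); apply: emit_output.
Qed.

Lemma polytime_translate : polytime (fun w => pre ++ translate s true [::] w).
Proof.
(* The exact running time: two steps per token, one per letter of [pre], and the halting step. *)
exists translator, ('X *+ 2 + (size pre).+1%:P)%R => w.
have [t0 [t1 [t2 [e in0 stk1 out2]]]] := translator_prefix w (leqnn _).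
exists ((size w).*2.+1 + size pre).
  by rewrite !hornerE -addnn addSnnS; apply: leqnn.
rewrite iterD e.
have -> : inord (size pre) = ord_max :> 'I_(size pre).+1.
  by apply: val_inj; rewrite /= inordK.
have [fin []] := translator_input in0 stk1 out2.
rewrite take_size => e1 [n e2]; split=> //; exists 0, n.
by rewrite e1 e2 revK.
Qed.

End Machine.

Theorem theorem37 (A : finType) (A_nonempty : 0 < #|A|) (X : logic) :
  polytime_reducible (dual_validity A X) (characteristic_formula A X).
Proof.
have [a _] := card_gt0P A_nonempty.
pose s := box_free X; pose zero := normal s false (deadlock A).
(* The output up to the operand of the diamond; it does not depend on the input, so it can be built
   into the machine. *)
pose pre := KOr :: polish zero ++ [:: KDia a].
exists (fun w => pre ++ translate s true [::] w).
  exact: polytime_translate.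
move=> phi dual_phi; exists (Or zero (Dia a (normal s true phi))).
have Xzero : in_logic X zero := normal_deadlock_in_logic A X.
have Xpsi := normal_in_logic dual_phi; split.
- exact/in_logic_or/in_logic_dia.
- have -> : encode phi = polish phi ++ [::] by rewrite cats0.
  by rewrite translate_polish cats0 /= -catA.
- apply: characteristic_valid => // M p; exact: sat_normal.
Qed.
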